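(* Let $q$ be a prime power, $h\ge 2$, $2\le k\le q^h-1$, and let $r_0$ be an integer with $1\le r_0\le h/2$. Put $V:=(\mathbb{F}_{q^h})^{k-1}\times(\mathbb{F}_q)^{r_0}$, regarded as an $\mathbb{F}_q$-vector space of dimension $r=(k-1)h+r_0$. Let $\xi\in\mathbb{F}_{q^h}$ be such that $\{1,\xi,\dots,\xi^{h-1}\}$ is an $\mathbb{F}_q$-basis of $\mathbb{F}_{q^h}$. Let $S_1,S_2$ be $\mathbb{F}_q$-subspaces of $\mathbb{F}_{q^h}$ with $\dim_{\mathbb{F}_q}S_1=\dim_{\mathbb{F}_q}S_2=r_0$ and $S_1\cap S_2=\{0\}$. For $\alpha\in\mathbb{F}_{q^h}$ define $$W_\alpha:=\Big\{(x_1,\dots,x_{k-1},z_1,\dots,z_{r_0})\in V:\ \sum_{i=1}^{k-1}\alpha^{i-1}x_i+\alpha^{k-1}\sum_{j=1}^{r_0}\xi^{j-1}z_j=0\Big\},$$ and for $i\in\{1,2\}$ define $$W_{\infty_i}:=\{(x_1,\dots,x_{k-2},s,0,\dots,0)\in V:\ x_1,\dots,x_{k-2}\in\mathbb{F}_{q^h},\ s\in S_i\}.$$ Then the family $L:=\{W_\alpha:\alpha\in\mathbb{F}_{q^h}\}\cup\{W_{\infty_1},W_{\infty_2}\}$ of $q^h+2$ subspaces is a $(k-1)$-packing of $V$.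
   Context: A family of $\mathbb{F}_q$-subspaces of an $\mathbb{F}_q$-vector space $V$ is a $\lambda$-packing if every $1$-dimensional $\mathbb{F}_q$-subspace of $V$ is contained in at most $\lambda$ members of the family. Convention: $0^0=1$ (so for $\alpha=0$ the term with $i=1$ equals $x_1$). *)

(* Defs.v *)
From HB Require Import structures.
From mathcomp Require Import all_boot all_algebra all_field.
Set Implicit Arguments. Unset Strict Implicit. Unset Printing Implicit Defensive.
Import GRing.Theory.
Local Open Scope ring_scope.

(* Every point of V lies in at most lam members of the family L, members being
   counted with multiplicity. *)
Definition is_packing (F : fieldType) (V : vectType F) (lam : nat)
    (L : seq {vspace V}) : Prop :=
  forall P : {vspace V}, \dim P = 1%N -> (count (fun W => (P <= W)%VS) L <= lam)%N.

Section Family.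
Variables (F : finFieldType) (K : fieldExtType F) (k r0 : nat).

(* K ^ (k - 1) * F ^ r0 over F. Coordinates are numbered from 0: x_i is v.1 at
   index i - 1 and z_j is v.2 0 at index j - 1. *)
Definition space : vectType F := ({ffun 'I_k.-1 -> K} * 'rV[F]_r0)%type.

Definition Wform (xi alpha : K) (v : space) : K :=
  \sum_(i < k.-1) alpha ^+ i * v.1 i
    + alpha ^+ k.-1 * \sum_(j < r0) v.2 0 j *: xi ^+ j.

Fact Wform_linear xi alpha : linear (Wform xi alpha).
Proof.
move=> a u v; rewrite /Wform scalerDr addrACA; congr (_ + _).
  rewrite scaler_sumr -big_split; apply: eq_bigr => i _ /=.
  by rewrite !ffunE mulrDr scalerAr.
rewrite scalerAr -mulrDr scaler_sumr -big_split; congr (_ * _).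
by apply: eq_bigr => j _ /=; rewrite !mxE scalerDl scalerA.
Qed.

HB.instance Definition _ xi alpha :=
  GRing.isLinear.Build F space K *:%R (Wform xi alpha) (Wform_linear xi alpha).

Definition W (xi alpha : K) : {vspace space} := lker (linfun (Wform xi alpha)).

Lemma mem_W xi alpha v : (v \in W xi alpha) = (Wform xi alpha v == 0).
Proof. by rewrite memv_ker lfunE. Qed.

Definition xcoord (i : 'I_k.-1) (v : space) : K := v.1 i.

Fact xcoord_linear i : linear (xcoord i).
Proof. by move=> a u v; rewrite /xcoord /= !ffunE. Qed.

HB.instance Definition _ i :=
  GRing.isLinear.Build F space K *:%R (xcoord i) (xcoord_linear i).

Definition zcoord (v : space) : 'rV[F]_r0 := v.2.

Fact zcoord_linear : linear zcoord.
Proof. by []. Qed.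

HB.instance Definition _ :=
  GRing.isLinear.Build F space 'rV[F]_r0 *:%R zcoord zcoord_linear.

(* For k >= 2 the only i with i.+2 == k is the index k - 2 of x_(k-1). *)
Definition Winfty (S : {vspace K}) : {vspace space} :=
  (\bigcap_(i < k.-1 | i.+2 == k) (linfun (xcoord i) @^-1: S)
     :&: lker (linfun zcoord))%VS.

Lemma mem_Winfty S v :
  (v \in Winfty S) <->
  (forall i : 'I_k.-1, i.+2 = k -> v.1 i \in S) /\ v.2 = 0.
Proof.
have mem_cap (i : 'I_k.-1) : (v \in linfun (xcoord i) @^-1: S)%VS = (v.1 i \in S).
  by rewrite -memv_preim lfunE.
rewrite /Winfty memv_cap memv_ker lfunE /= memvE; split.
  case/andP=> /subv_bigcapP vS /eqP v0; split=> // i /eqP/vS.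
  by rewrite -memvE mem_cap.
case=> vS v0; apply/andP; split; last exact/eqP.
by apply/subv_bigcapP => i /eqP/vS; rewrite -memvE mem_cap.
Qed.

(* finvect_type K is K with its finType structure, as a finite-dimensional
   space over a finite field. *)
Definition subspace_family (xi : K) (S1 S2 : {vspace K}) : seq {vspace space} :=
  [seq W xi (alpha : K) | alpha : finvect_type K] ++ [:: Winfty S1; Winfty S2].

Lemma dim_space : \dim {: space} = (k.-1 * \dim {: K} + r0)%N.
Proof.
rewrite !dimvf; transitivity (#|'I_k.-1| * dim K + 1 * r0)%N; first by [].
by rewrite card_ord mul1n.
Qed.

End Family.

(* Main.v *)
Require Import Defs.
From mathcomp Require Import all_boot all_algebra all_field.
Local Open Scope ring_scope.

(** A vector v of V is encoded by the polynomial whose coefficients are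
    x_1, ..., x_(k-1), c, where c := \sum_j xi^(j-1) z_j; it is non-zero when v
    is, and v lies in W_alpha exactly when alpha is a root.  Lying in one of the
    spaces W_infty costs the coefficient c, and lying in both of them costs
    x_(k-1) as well, so each such membership lowers the bound on the number of
    roots by one. *)

Import GRing.Theory.

Section Packing.
Context {F : finFieldType} {K : fieldExtType F} {k r0 : nat}.
Hypotheses (k_gt1 : (1 < k)%N) (r0_gt0 : (0 < r0)%N).

Local Notation space := (Defs.space K k r0).

Definition zcomb (xi : K) (z : 'rV[F]_r0) : K := \sum_(j < r0) z 0 j *: xi ^+ j.

Definition Wpoly (xi : K) (v : space) : {poly K} :=
  \sum_(i < k.-1) v.1 i *: 'X^i + zcomb xi v.2 *: 'X^(k.-1).

Lemma root_Wpoly xi alpha v : root (Wpoly xi v) alpha = (v \in W k r0 xi alpha).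
Proof.
rewrite mem_W rootE /Wpoly /Wform hornerD hornerZ hornerXn horner_sum.
rewrite [zcomb _ _ * _]mulrC; congr (_ + _ == _); apply: eq_bigr => i _.
by rewrite hornerZ hornerXn mulrC.
Qed.

Lemma coef_Wpoly xi v (i : 'I_k.-1) : (Wpoly xi v)`_i = v.1 i.
Proof.
rewrite coefD coefZ coefXn (ltn_eqF (ltn_ord i)) mulr0 addr0 coef_sum.
rewrite (bigD1 i) //= coefZ coefXn eqxx mulr1 big1 ?addr0 // => j ne_ji.
by rewrite coefZ coefXn val_eqE eq_sym (negPf ne_ji) mulr0.
Qed.

Lemma coef_Wpoly_large xi v j : (k.-1 <= j)%N ->
  (Wpoly xi v)`_j = if j == k.-1 then zcomb xi v.2 else 0.
Proof.
move=> le_kj; rewrite coefD coefZ coefXn coef_sum big1 ?add0r => [|i _].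
  by case: eqP => _; rewrite ?mulr1 ?mulr0.
by rewrite coefZ coefXn gtn_eqF ?mulr0 // (leq_trans (ltn_ord i)).
Qed.

Lemma size_Wpoly xi v : (size (Wpoly xi v) <= k)%N.
Proof.
apply/leq_sizeP => j le_kj.
by rewrite coef_Wpoly_large ?gtn_eqF ?(leq_trans _ le_kj) ?leq_pred // prednK // ltnW.
Qed.

Lemma size_Wpoly_Winfty xi v S :
  v \in Winfty k r0 S -> (size (Wpoly xi v) <= k.-1)%N.
Proof.
case/mem_Winfty => _ z0; apply/leq_sizeP => j /coef_Wpoly_large ->.
by rewrite z0 /zcomb big1 ?if_same // => i _; rewrite mxE scale0r.
Qed.

(** Both memberships together put $x_{k-1}$ in $S_1 \cap S_2 = 0$, so the coefficient of index $k-2$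
    vanishes as well. *)
Lemma size_Wpoly_Winfty2 xi v S1 S2 : (S1 :&: S2)%VS = 0%VS ->
    v \in Winfty k r0 S1 -> v \in Winfty k r0 S2 ->
  (size (Wpoly xi v) <= k.-2)%N.
Proof.
move=> S12 v1 v2; apply/leq_sizeP => j le_kj.
have [le_j|gt_j] := leqP k.-1 j.
  by have /leq_sizeP-> := size_Wpoly_Winfty xi v _ v1.
rewrite (coef_Wpoly xi v (Ordinal gt_j)).
(* The bounds on [j] leave only $k-2$, the one index at which [Winfty] constrains [v.1]. *)
have j2 : (Ordinal gt_j).+2 = k.
  move: k_gt1 le_kj gt_j {v v1 v2} => /=; case: (k) => [|[|m]] //= _.
  by rewrite ltnS => m_le le_m; congr _.+2; apply/eqP; rewrite eqn_leq le_m.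
apply/eqP; rewrite -memv0 -S12 memv_cap.
by case/mem_Winfty: v1 => -> // _; case/mem_Winfty: v2 => -> // _.
Qed.

Lemma zcomb_eq0 (xi : K) z :
  free [seq xi ^+ i | i <- iota 0 r0] -> zcomb xi z = 0 -> z = 0.
Proof.
move=> fr z0; pose X := [tuple xi ^+ i | i < r0].
have /freeP frX : free X.
  by rewrite /= -[X in free X]/[seq xi ^+ val i | i <- enum 'I_r0] map_comp val_enum_ord.
apply/rowP => j; rewrite mxE; apply: (frX (z 0)); rewrite -[RHS]z0.
by apply: eq_bigr => i _; rewrite -tnth_nth tnth_mktuple.
Qed.

(** The coefficients determine [v]: those below $k-1$ are the $x_i$, and the one at $k-1$ yields [z]
    because the powers of [xi] are free. *)
Lemma Wpoly_neq0 (xi : K) v :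
  free [seq xi ^+ i | i <- iota 0 r0] -> v != 0 -> Wpoly xi v != 0.
Proof.
move=> fr; apply: contraNneq => p0; apply/eqP.
have z0 : v.2 = 0.
  apply: (zcomb_eq0 xi) => //.
  by have := coef_Wpoly_large xi v _ (leqnn k.-1); rewrite p0 coef0 eqxx.
have x0 : v.1 = 0.
  by apply/ffunP => i; rewrite -(coef_Wpoly xi) p0 coef0 ffunE.
by case: v z0 x0 {p0} => x z /= -> ->.
Qed.

(** If [v] spans the point and lies in $t$ of the two spaces at infinity, its polynomial has size at
    most $k-t$, hence at most $k-t-1$ roots; the total is at most $k-1$. *)
Lemma subspace_family_packing (xi : K) S1 S2 :
    free [seq xi ^+ i | i <- iota 0 r0] -> (S1 :&: S2)%VS = 0%VS ->
  is_packing (k - 1) (subspace_family k r0 xi S1 S2).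
Proof.
move=> fr S12 P dimP; pose v := vpick P.
have v0 : v != 0 by rewrite vpick0 -dimv_eq0 dimP.
have -> : P = <[v]>%VS.
  by apply/esym/eqP; rewrite eqEdim dim_vline v0 dimP -memvE memv_pick.
rewrite count_cat count_map /=.
set n := count _ _.
(* The [n] parameters counted are distinct roots of a non-zero polynomial. *)
have n_lt : (n < size (Wpoly xi v))%N.
  rewrite /n -size_filter; apply: (max_poly_roots (Wpoly_neq0 xi v fr v0)).
    by apply/allP => a; rewrite mem_filter /= root_Wpoly memvE => /andP[].
  by apply: filter_uniq; apply: (@enum_uniq (finvect_type K)).
rewrite -!memvE addn0 subn1 addnA.
case v1: (v \in Winfty k r0 S1); case v2: (v \in Winfty k r0 S2);
  rewrite !(addn0, addn1).
- have := leq_trans n_lt (size_Wpoly_Winfty2 xi v _ _ S12 v1 v2).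
  (* For $k = 2$ the bound reads [n < 0]: no point lies in both spaces at infinity. *)
  by case: (k) => [|[|m]].
- exact: leq_trans n_lt (size_Wpoly_Winfty xi v _ v1).
- exact: leq_trans n_lt (size_Wpoly_Winfty xi v _ v2).
- have := leq_trans n_lt (size_Wpoly xi v).
  by case: (k).
Qed.

(* The vector encoded by the polynomial X^(k-1) - alpha X^(k-2). *)
Definition Wwitness (alpha : K) : space :=
  ([ffun i : 'I_k.-1 => if i.+2 == k then - alpha else 0],
   delta_mx 0 (Ordinal r0_gt0)).

(** This is the value at [beta] of $X^{k-2}(X - \alpha)$. For [beta != 0] it vanishes only at
    [beta = alpha], which tells the spaces [W] apart. *)
Lemma Wform_Wwitness xi alpha beta :
  Wform xi beta (Wwitness alpha) = beta ^+ k.-2 * (beta - alpha).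
Proof.
have k2 : (k.-2 < k.-1)%N by case: (k) k_gt1 => [|[]].
have k2E : k.-2.+2 = k by case: (k) k_gt1 => [|[]].
rewrite /Wform /= (bigD1 (Ordinal k2)) //= ffunE /= k2E eqxx big1 ?addr0.
  rewrite (bigD1 (Ordinal r0_gt0)) //= mxE !eqxx scale1r big1 ?addr0.
    have -> : k.-1 = k.-2.+1 by case: (k) k_gt1 => [|[]].
    by rewrite expr0 mulr1 exprSr mulrBr mulrN addrC.
  by move=> j /negPf ne_j; rewrite mxE ne_j andbF scale0r.
move=> i; rewrite -val_eqE /= => ne_i; rewrite ffunE ifN ?mulr0 //.
by apply: contraNN ne_i => /eqP i2; rewrite -[i : nat]/(i.+2.-2) i2.
Qed.

Lemma mem_Wwitness xi alpha : Wwitness alpha \in W k r0 xi alpha.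
Proof. by rewrite mem_W Wform_Wwitness subrr mulr0. Qed.

Lemma Wwitness_notin_Winfty alpha S : Wwitness alpha \notin Winfty k r0 S.
Proof.
apply/negP => /mem_Winfty[_ /rowP/(_ (Ordinal r0_gt0))/eqP].
by rewrite !mxE !eqxx oner_eq0.
Qed.

(** The witness of [a] lies in the space of a non-zero [b] only if [a = b]. Of two distinct
    parameters one is non-zero, and it can be given the role of [b]. *)
Lemma W_inj (xi : K) : injective (W k r0 xi).
Proof.
have sub a b : b != 0 -> W k r0 xi a = W k r0 xi b -> a = b.
  move=> b0 eqW; have := mem_Wwitness xi a; rewrite eqW mem_W Wform_Wwitness.
  by rewrite mulf_eq0 expf_eq0 (negPf b0) andbF subr_eq0 => /eqP.
move=> a b eqW; have [b0|b0] := eqVneq b 0; last exact: sub.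
by have [a0|a0] := eqVneq a 0; [rewrite a0 | apply/esym/sub].
Qed.

Lemma W_neq_Winfty (xi alpha : K) S : W k r0 xi alpha != Winfty k r0 S.
Proof.
by apply: contraNneq (Wwitness_notin_Winfty alpha S) => <-; apply: mem_Wwitness.
Qed.

Lemma Winfty_sub (S1 S2 : {vspace K}) : Winfty k r0 S1 = Winfty k r0 S2 -> (S1 <= S2)%VS.
Proof.
move=> eqW; apply/subvP => s s1.
have k2 : (k.-2 < k.-1)%N by case: (k) k_gt1 => [|[]].
have k2E : k.-2.+2 = k by case: (k) k_gt1 => [|[]].
(* Only the last $x$-coordinate is tested against the subspace, so a constant function serves. *)
pose v : space := ([ffun => s], 0).
have : v \in Winfty k r0 S1 by apply/mem_Winfty; split=> // i _; rewrite ffunE.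
rewrite eqW => /mem_Winfty[/(_ (Ordinal k2) k2E) + _].
by rewrite ffunE.
Qed.

(** Equality of the two spaces at infinity would give $S_1 \subseteq S_2$, hence $S_1 = S_1 \cap S_2
    = 0$. *)
Lemma subspace_family_uniq (xi : K) S1 S2 : S1 != 0%VS ->
  (S1 :&: S2)%VS = 0%VS -> uniq (subspace_family k r0 xi S1 S2).
Proof.
move=> S1n0 S12; rewrite cat_uniq map_inj_uniq ?enum_uniq; last exact: W_inj.
have notW S : (Winfty k r0 S \in [seq W k r0 xi (a : K) | a : finvect_type K]) = false.
  by apply/negP => /imageP[a _ /esym/eqP]; rewrite (negPf (W_neq_Winfty _ _ _)).
rewrite /= !notW inE !andbT /=; apply: contra S1n0 => /eqP/Winfty_sub/capv_idPl.
by rewrite S12 => <-.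
Qed.

End Packing.

Theorem theorem4p3 (p e q h k r0 : nat)
    (hp : prime p) (he : (0 < e)%N) (hq : q = (p ^ e)%N)
    (hh : (2 <= h)%N)
    (hk2 : (2 <= k)%N) (hkq : (k <= q ^ h - 1)%N)
    (hr1 : (1 <= r0)%N) (hrh : (2 * r0 <= h)%N)
    (F : finFieldType) (hF : #|F| = q)
    (K : fieldExtType F) (hK : \dim {: K} = h)
    (xi : K) (hxi : basis_of {: K} [seq xi ^+ i | i <- iota 0 h])
    (S1 S2 : {vspace K})
    (hS1 : \dim S1 = r0) (hS2 : \dim S2 = r0) (hS : (S1 :&: S2)%VS = 0%VS) :
  [/\ size (subspace_family k r0 xi S1 S2) = (q ^ h + 2)%N,
      uniq (subspace_family k r0 xi S1 S2)
    & is_packing (k - 1) (subspace_family k r0 xi S1 S2)].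
Proof.
have le_rh : (r0 <= h)%N by rewrite (leq_trans _ hrh) // leq_pmull.
have fr : free [seq xi ^+ i | i <- iota 0 r0].
  (* The first [r0] powers form a prefix of the basis. *)
  have := basis_free hxi; rewrite -(subnKC le_rh) iotaD map_cat.
  exact: catl_free.
split.
- rewrite size_cat size_map -cardE /=; congr (_ + _)%N.
  (* The parameters range over the finite copy of [K], whose cardinality is that of [F] to the power
     $\dim K = h$. *)
  pose cK := Vector.class (finvect_type K : vectType F).
  by rewrite -(card_vspacef cK) card_vspace hF -hK.
- by apply: subspace_family_uniq => //; rewrite -dimv_eq0 hS1 -lt0n.
- exact: subspace_family_packing.
Qed.
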